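(* Let $A$ be a $0$-$1$ matrix (possibly with no rows and columns), and let \[P'=\begin{pmatrix} A & \mathbf{0}\\ \mathbf{0} & 1\end{pmatrix},\qquad P=\begin{pmatrix} A & \mathbf{0} & \mathbf{0}\\ \mathbf{0} & 1 & 0\\ \mathbf{0} & 0 & 1\end{pmatrix},\] i.e. $P'$ is obtained from $A$ by adding a new last row and a new last column whose only $1$ entry is at their intersection, and $P$ is obtained from $P'$ in the same way. Then for all positive integers $m,n$, \[ex(P,m,n)=ex(P',m-1,n-1)+m+n-1,\qquad sat(P,m,n)=sat(P',m-1,n-1)+m+n-1.\]
   Context: All matrices are $0$-$1$ matrices; an $m\times n$ matrix has $m$ rows and $n$ columns. The weight of a matrix is its number of $1$ entries. A matrix $M$ contains a $k\times l$ pattern $P$ if there are rows $r_1<\dots<r_k$ and columns $c_1<\dots<c_l$ of $M$ such that $M(r_a,c_b)=1$ whenever $P(a,b)=1$; otherwise $M$ avoids $P$. $ex(P,m,n)$ is the maximum weight of an $m\times n$ matrix avoiding $P$. A matrix $M$ is saturating for $P$ if $M$ avoids $P$ and changing any single $0$ entry of $M$ to $1$ yields a matrix containing $P$. $sat(P,m,n)$ is the minimum weight of an $m\times n$ matrix saturating for $P$. A matrix with zero rows or zero columns has weight $0$, so $ex$ and $sat$ equal $0$ when a dimension is $0$. *)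

(* Defs.v *)
From mathcomp Require Import all_boot all_order all_algebra.

Set Implicit Arguments.
Unset Strict Implicit.
Unset Printing Implicit Defensive.

(* A 0-1 matrix is an element of 'M[bool]_(m, n), with true standing for 1.
   Dimensions 0 are allowed. *)

Definition weight m n (M : 'M[bool]_(m, n)) : nat :=
  #|[set p : 'I_m * 'I_n | M p.1 p.2]|.

Definition increasing k m (f : {ffun 'I_k -> 'I_m}) : bool :=
  [forall a : 'I_k, forall b : 'I_k, (a < b) ==> (f a < f b)].

Definition contains k l m n (P : 'M[bool]_(k, l)) (M : 'M[bool]_(m, n)) : bool :=
  [exists r : {ffun 'I_k -> 'I_m}, exists c : {ffun 'I_l -> 'I_n},
    [&& increasing r, increasing c &
        [forall a : 'I_k, forall b : 'I_l, P a b ==> M (r a) (c b)]]].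

Definition avoids k l m n (P : 'M[bool]_(k, l)) (M : 'M[bool]_(m, n)) : bool :=
  ~~ contains P M.

Definition set_one m n (M : 'M[bool]_(m, n)) (i0 : 'I_m) (j0 : 'I_n) :
    'M[bool]_(m, n) :=
  \matrix_(i, j) (((i == i0) && (j == j0)) || M i j).

Definition saturating k l m n (P : 'M[bool]_(k, l)) (M : 'M[bool]_(m, n)) : bool :=
  avoids P M &&
  [forall i : 'I_m, forall j : 'I_n, ~~ M i j ==> contains P (set_one M i j)].

Definition ex_max k l (P : 'M[bool]_(k, l)) (m n : nat) : nat :=
  \max_(M : 'M[bool]_(m, n) | avoids P M) weight M.

(* The default m * n bounds every weight, so it does not affect the minimum
   as soon as a saturating matrix exists; see sat_minP and saturating_exists. *)
Definition sat_min k l (P : 'M[bool]_(k, l)) (m n : nat) : nat :=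
  \big[minn/(m * n)]_(M : 'M[bool]_(m, n) | saturating P M) weight M.

Definition add_corner k l (A : 'M[bool]_(k, l)) : 'M[bool]_(k + 1, l + 1) :=
  block_mx A (const_mx false) (const_mx false) (const_mx true).

Lemma weight_le m n (M : 'M[bool]_(m, n)) : weight M <= m * n.
Proof.
by rewrite /weight (leq_trans (max_card _)) // card_prod !card_ord.
Qed.

Lemma avoids_const0 k l m n (P : 'M[bool]_(k, l)) (a : 'I_k) (b : 'I_l) :
  P a b -> avoids P (const_mx false : 'M[bool]_(m, n)).
Proof.
move=> Pab; apply/negP => /existsP[r /existsP[c /and3P[_ _ /forallP/(_ a)]]].
by move=> /forallP/(_ b); rewrite Pab mxE.
Qed.

Lemma ex_maxP k l (P : 'M[bool]_(k, l)) m n (M0 : 'M[bool]_(m, n)) :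
    avoids P M0 ->
  (exists2 M : 'M[bool]_(m, n), avoids P M & weight M = ex_max P m n) /\
  (forall M : 'M[bool]_(m, n), avoids P M -> weight M <= ex_max P m n).
Proof.
move=> aM0; split=> [|M aM]; last exact: leq_bigmax_cond.
have [|M aM eM] := @eq_bigmax_cond _ (avoids P (m := m) (n := n)) (@weight m n).
  by apply/card_gt0P; exists M0.
by exists M => //; rewrite -eM.
Qed.

Lemma sat_minP k l (P : 'M[bool]_(k, l)) m n (M0 : 'M[bool]_(m, n)) :
    saturating P M0 ->
  (exists2 M : 'M[bool]_(m, n), saturating P M & weight M = sat_min P m n) /\
  (forall M : 'M[bool]_(m, n), saturating P M -> sat_min P m n <= weight M).
Proof.
move=> sM0.
have lb (M : 'M[bool]_(m, n)) : saturating P M -> sat_min P m n <= weight M.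
  move=> sM; rewrite /sat_min; have := mem_index_enum M.
  elim: (index_enum _) => //= N r IHr; rewrite inE big_cons.
  case/predU1P=> [<-|/IHr leM]; first by rewrite sM geq_minl.
  by case: ifP => // _; rewrite geq_min leM orbT.
split=> //; case: (arg_minnP (@weight m n) sM0) => M sM minM; exists M => //.
apply/eqP; rewrite eqn_leq lb // andbT /sat_min.
by elim/big_ind: _ => [|x y lx ly|N /minM //]; rewrite ?weight_le // leq_min lx.
Qed.

Lemma saturating_exists k l (P : 'M[bool]_(k, l)) m n (M0 : 'M[bool]_(m, n)) :
  avoids P M0 -> exists M : 'M[bool]_(m, n), saturating P M.
Proof.
move=> aM0; have [[M aM wM] maxM] := ex_maxP aM0; exists M.
rewrite /saturating aM; apply/forallP => i; apply/forallP => j.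
apply/implyP => Mij; apply: contraT => /maxM; rewrite -wM leqNgt => /negP[].
apply/proper_card/properP; split.
  by apply/subsetP => p; rewrite !inE mxE => ->; rewrite orbT.
by exists (i, j); rewrite !inE ?mxE ?eqxx.
Qed.

(* Main.v *)
Require Import Defs.
From mathcomp Require Import all_boot all_order all_algebra.
From mathcomp Require Import zify.

(** Call a cell of an m x n matrix M dominated if some 1 entry lies strictly
    below and to the right of it.  At most one 1 entry on each of the m + n - 1
    diagonals is undominated, and the dominated 1 entries form an
    (m-1) x (n-1) matrix M' which avoids P' as soon as M avoids P.  Conversely,
    bordering a matrix by a last row and a last column of ones turns a matrix
    avoiding (saturating for) P' into one avoiding (saturating for) P.

    For the lower bound on sat, let M be saturating for P.  An undominated 0
    entry can only complete P as its last corner, so P' already occurs strictly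
    above and to the left of it.  Walking up a diagonal from its last cell
    through such zeros must therefore end in an undominated 1 entry, so every
    diagonal has exactly one.  Moreover M' is saturating for P': for a 0 entry
    of M' which is undominated in M, its lower right diagonal neighbour is an
    undominated 0 entry of M, and the corner of the copy of P' found there can
    be moved to the entry in question. *)

Set Implicit Arguments.
Unset Strict Implicit.
Unset Printing Implicit Defensive.

(* Matrices are handled as relations on nat cut off at the given dimensions,
   so that submatrices of different sizes share the same coordinates. *)
Definition occurs k l (P : 'M[bool]_(k, l)) (Q : rel nat) (u v : nat) : Prop :=
  exists (r : 'I_k -> nat) (c : 'I_l -> nat),
  [/\ {homo r : a b / a < b}, {homo c : a b / a < b},
      forall a, r a < u, forall b, c b < v & forall a b, P a b -> Q (r a) (c b)].

Definition add_one (Q : rel nat) (i0 j0 : nat) : rel nat :=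
  fun i j => (i == i0) && (j == j0) || Q i j.

Definition saturates k l (P : 'M[bool]_(k, l)) (Q : rel nat) m n : Prop :=
  ~ occurs P Q m n /\
  forall i j, i < m -> j < n -> ~~ Q i j -> occurs P (add_one Q i j) m n.

Definition to_mx m n (Q : rel nat) : 'M[bool]_(m, n) := \matrix_(i, j) Q i j.

(** The existential makes the relation total on [nat], false outside the dimensions. *)
Definition entry m n (M : 'M[bool]_(m, n)) : rel nat := fun i j =>
  [exists p : 'I_m * 'I_n, [&& p.1 == i :> nat, p.2 == j :> nat & M p.1 p.2]].

Lemma entryK m n : cancel (@entry m n) (@to_mx m n).
Proof.
move=> M; apply/matrixP => i j; rewrite mxE; apply/existsP/idP => /= [|Mij].
  by case=> -[a b] /and3P[/= /eqP/val_inj -> /eqP/val_inj ->].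
by exists (i, j); rewrite !eqxx.
Qed.

Lemma containsP k l (P : 'M[bool]_(k, l)) m n Q :
  reflect (occurs P Q m n) (contains P (to_mx m n Q)).
Proof.
apply: (iffP existsP) => [[r /existsP[c /and3P[rI cI rcP]]]|].
  exists (fun a => nat_of_ord (r a)), (fun b => nat_of_ord (c b)); split=> // a b.
  - by move: rI => /forallP/(_ a)/forallP/(_ b)/implyP.
  - by move: cI => /forallP/(_ a)/forallP/(_ b)/implyP.
  - by move: rcP => /forallP/(_ a)/forallP/(_ b)/implyP; rewrite mxE.
case=> r [c [rI cI rm cn rcP]].
exists [ffun a => Ordinal (rm a)]; apply/existsP.
exists [ffun b => Ordinal (cn b)]; apply/and3P; split;
  apply/forallP => a; apply/forallP => b; apply/implyP; rewrite ?mxE !ffunE /=.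
- exact: rI.
- exact: cI.
- exact: rcP.
Qed.

Lemma avoidsP k l (P : 'M[bool]_(k, l)) m n Q :
  reflect (~ occurs P Q m n) (avoids P (to_mx m n Q)).
Proof. by apply: (iffP negP) => nPQ /containsP. Qed.

Lemma set_one_to_mx m n Q (i : 'I_m) (j : 'I_n) :
  set_one (to_mx m n Q) i j = to_mx m n (add_one Q i j).
Proof. by apply/matrixP => a b; rewrite !mxE. Qed.

Lemma saturatingP k l (P : 'M[bool]_(k, l)) m n Q :
  reflect (saturates P Q m n) (saturating P (to_mx m n Q)).
Proof.
apply: (iffP andP) => -[aQ sQ]; split; try exact/avoidsP.
  move=> i j im jn nQ; apply/containsP.
  move: sQ => /forallP/(_ (Ordinal im))/forallP/(_ (Ordinal jn))/implyP.
  by rewrite set_one_to_mx mxE; apply.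
apply/forallP => i; apply/forallP => j; apply/implyP; rewrite mxE => nQ.
by rewrite set_one_to_mx; apply/containsP/sQ.
Qed.

(** * Monotonicity of occurrences and patterns with an added corner *)

Lemma sub_occurs k l (P : 'M[bool]_(k, l)) (Q Q' : rel nat) u v u' v' :
    u <= u' -> v <= v' -> (forall i j, i < u -> j < v -> Q i j -> Q' i j) ->
  occurs P Q u v -> occurs P Q' u' v'.
Proof.
move=> uu' vv' QQ' [r [c [rI cI ru cv rcP]]]; exists r, c; split=> // *.
- exact: leq_trans uu'.
- exact: leq_trans vv'.
- by apply: QQ' => //; apply: rcP.
Qed.

(** The added row and column come last, so the cell hosting the corner cuts off the window that
    holds the rest of the copy. *)
Lemma occurs_add_corner k l (B : 'M[bool]_(k, l)) (Q : rel nat) u v :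
  occurs (add_corner B) Q u v <->
  exists i j, [/\ i < u, j < v, Q i j & occurs B Q i j].
Proof.
split=> [[r [c [rI cI ru cv rcP]]]|[i [j [iu jv Qij [r [c [rI cI ri cj rcP]]]]]]].
  exists (r (rshift k ord0)), (c (rshift l ord0)); split=> //.
    by apply: rcP; rewrite block_mxEdr mxE.
  exists (fun a => r (lshift 1 a)), (fun b => c (lshift 1 b)).
  split=> [a b ab|a b ab|a|b|a b Bab].
  - exact: rI.
  - exact: cI.
  - by apply: rI; rewrite /= addn0.
  - by apply: cI; rewrite /= addn0.
  - by apply: rcP; rewrite block_mxEul.
pose ext p (f : 'I_p -> nat) x (a : 'I_(p + 1)) :=
  if split a is inl b then f b else x.
have extI p f x : {homo f : a b / (a : 'I_p) < b >-> a < b} ->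
    (forall a, f a < x) -> {homo @ext p f x : a b / a < b}.
  move=> fI fx a b; rewrite /ext.
  case: splitP => a' ->; case: splitP => b' -> //; first exact: fI.
    by have := ltn_ord b'; lia.
  by rewrite !ord1 ltnn.
exists (ext k r i), (ext l c j); split=> [||a|b|a b]; rewrite /ext.
- exact: extI.
- exact: extI.
- by case: (split a) => // ?; apply: ltn_trans iu.
- by case: (split b) => // ?; apply: ltn_trans jv.
rewrite /add_corner mxE; case: (split a) => a'; rewrite mxE;
  case: (split b) => b' //; [exact: rcP | by rewrite mxE..].
Qed.

(** * Dominated entries, in general and in saturating matrices *)

Definition dominated m n (Q : rel nat) : rel nat := fun i j =>
  [exists p : 'I_m * 'I_n, [&& i < p.1, j < p.2 & Q p.1 p.2]].

Lemma dominatedP m n (Q : rel nat) i j :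
  reflect (exists i' j', [/\ i < i' < m, j < j' < n & Q i' j'])
          (dominated m n Q i j).
Proof.
apply: (iffP existsP) => [[[a b] /and3P[/= ia jb Qab]]|].
  by exists a, b; rewrite ia jb !ltn_ord.
case=> a [b [/andP[ia am] /andP[jb bn] Qab]].
by exists (Ordinal am, Ordinal bn); rewrite /= ia jb.
Qed.

Definition nonmaximal m n (Q : rel nat) : rel nat :=
  fun i j => Q i j && dominated m n Q i j.

(** The corner of a copy of [add_corner A] is itself dominated, and the 1 dominating it would
    complete the larger pattern. *)
Lemma nonmaximal_avoids k l (A : 'M[bool]_(k, l)) (Q : rel nat) m n :
    ~ occurs (add_corner (add_corner A)) Q m.+1 n.+1 ->
  ~ occurs (add_corner A) (nonmaximal m.+1 n.+1 Q) m n.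
Proof.
move=> aQ /occurs_add_corner[i [j [im jn /andP[Qij]]]].
case/dominatedP=> i' [j' [/andP[ii' i'm] /andP[jj' j'n] Qi'j']] oA; apply: aQ.
apply/occurs_add_corner; exists i', j'; split=> //.
apply/occurs_add_corner; exists i, j; split=> //.
by apply: sub_occurs oA => // a b _ _ /andP[].
Qed.

(** The corner of the new copy is either the changed cell or an old 1. In the second case the
    changed cell lies strictly before that corner, since otherwise the copy would already exist in
    [Q]. *)
Lemma saturates_zero k l (B : 'M[bool]_(k, l)) (Q : rel nat) m n i j :
    saturates (add_corner B) Q m n -> i < m -> j < n -> ~~ Q i j ->
  occurs B Q i j \/
  exists i' j', [/\ i < i' < m, j < j' < n, Q i' j' &
                    occurs B (add_one Q i j) i' j'].
Proof.
move=> [aQ sQ] im jn /(sQ _ _ im jn)/occurs_add_corner[i' [j' []]].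
move=> i'm j'n /orP[/andP[/eqP-> /eqP->]|Qi'j'] oB.
  left; apply: sub_occurs oB => // a b ai bj /orP[/andP[/eqP ab]|//].
  by rewrite ab ltnn in ai.
case: (boolP ((i < i') && (j < j'))) => [/andP[ii' jj']|nlt].
  by right; exists i', j'; rewrite ii' jj'.
case: aQ; apply/occurs_add_corner; exists i', j'; split=> //.
apply: sub_occurs oB => // a b ai bj /orP[/andP[/eqP ai' /eqP bj']|//].
by rewrite ai' in ai; rewrite bj' in bj; rewrite ai bj in nlt.
Qed.

Lemma undominated_zero k l (B : 'M[bool]_(k, l)) (Q : rel nat) m n i j :
    saturates (add_corner B) Q m n -> i < m -> j < n -> ~~ Q i j ->
  ~~ dominated m n Q i j -> occurs B Q i j.
Proof.
move=> sQ im jn nQ /dominatedP ndom.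
have [//|[i' [j' [ii' jj' Qi'j' _]]]] := saturates_zero sQ im jn nQ.
by case: ndom; exists i', j'.
Qed.

Lemma zero_after_occurrence k l (B : 'M[bool]_(k, l)) (Q : rel nat) m n i j i' j' :
    ~ occurs (add_corner B) Q m n -> occurs B Q i j ->
  i <= i' -> j <= j' -> i' < m -> j' < n -> ~~ Q i' j'.
Proof.
move=> aQ oB ii' jj' i'm j'n; apply/negP => Qi'j'; apply: aQ.
by apply/occurs_add_corner; exists i', j'; split=> //; apply: sub_occurs oB.
Qed.

Lemma nonmaximal_saturates k l (A : 'M[bool]_(k, l)) (Q : rel nat) m n :
    saturates (add_corner (add_corner A)) Q m.+1 n.+1 ->
  saturates (add_corner A) (nonmaximal m.+1 n.+1 Q) m n.
Proof.
move=> sQ; have [aQ _] := sQ; split=> [|i j im jn]; first exact: nonmaximal_avoids.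
case: (boolP (dominated m.+1 n.+1 Q i j)) => [dom|ndom _].
  rewrite /nonmaximal dom andbT => nQ; case/dominatedP: dom => i1 [j1 [ii1 jj1 Qij1]].
  have [oB|[i' [j' [ii' jj' Qij' oB]]]] :=
      saturates_zero sQ (leqW im) (leqW jn) nQ.
    (* The dominating 1 at [(i1, j1)] would complete this copy to the forbidden pattern. *)
    have [/andP[? ?] /andP[? ?]] := (ii1, jj1).
    suff: ~~ Q i1 j1 by rewrite Qij1.
    by apply: (zero_after_occurrence aQ oB) => //; apply: ltnW.
  have [/andP[? ?] /andP[? ?]] := (ii', jj').
  (* The 1 at [(i', j')] dominates every cell of this copy, so its old entries survive in
     [nonmaximal]. *)
  apply: sub_occurs oB => // a b ai bj /orP[ab|Qab]; apply/orP; [by left|right].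
  rewrite /nonmaximal Qab; apply/dominatedP.
  by exists i', j'; rewrite ai bj.
have nQ : ~~ Q i.+1 j.+1.
  apply: contra ndom => QS; apply/dominatedP; exists i.+1, j.+1.
  by rewrite !ltnSn.
have ndomS : ~~ dominated m.+1 n.+1 Q i.+1 j.+1.
  apply: contra ndom => /dominatedP[a [b [/andP[ia am] /andP[jb bn] Qab]]].
  by apply/dominatedP; exists a, b; rewrite !(ltnW ia, ltnW jb, am, bn).
have /occurs_add_corner[a [b [ai bj Qab oA]]] :=
  undominated_zero sQ (im : i.+1 < m.+1) (jn : j.+1 < n.+1) nQ ndomS.
(* As [a <= i] and [b <= j], the copy of [A] also lies before [(i, j)], and the 1 at [(a, b)]
   dominates its entries. *)
apply/occurs_add_corner; exists i, j; split=> //; first by rewrite /add_one !eqxx.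
apply: sub_occurs oA => // a' b' a'a b'b Qa'b'.
apply/orP; right; rewrite /nonmaximal Qa'b'; apply/dominatedP.
by exists a, b; rewrite a'a b'b (leq_trans ai) ?(leq_trans bj) //; lia.
Qed.

Lemma undominated_one_on_diagonal k l (A : 'M[bool]_(k, l)) (Q : rel nat) m n i j :
    saturates (add_corner (add_corner A)) Q m n -> i < m -> j < n ->
    ~~ dominated m n Q i j ->
  exists i' j', [/\ i' < m, j' < n, Q i' j' && ~~ dominated m n Q i' j' &
                    i' + j = i + j'].
Proof.
move=> sQ; have [aQ _] := sQ.
elim: i j => [|i IHi] j im jn ndom.
  case: (boolP (Q 0 j)) => [Qj|nQ]; first by exists 0, j; rewrite Qj ndom.
  by have /occurs_add_corner[a [b [//]]] := undominated_zero sQ im jn nQ ndom.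
case: (boolP (Q i.+1 j)) => [Qj|nQ]; first by exists i.+1, j; rewrite Qj ndom.
have oP := undominated_zero sQ im jn nQ ndom.
case: j => [|j] in jn ndom nQ oP *.
  by have /occurs_add_corner[a [b [//]]] := oP.
have [|||i' [j' [im' jn' Q' e]]] := IHi j _ _ _; try exact: ltnW.
  (* A 1 strictly beyond [(i, j)] is weakly beyond [(i.+1, j.+1)], so it would complete the copy in
     [oP]. *)
  apply/negP => /dominatedP[a [b [/andP[ia am] /andP[jb bn] Qab]]].
  by have := zero_after_occurrence aQ oP ia jb am bn; rewrite Qab.
by exists i', j'; split=> //; lia.
Qed.

(** * Weights and diagonals *)

Lemma weight_sum m n Q :
  weight (to_mx m n Q) = \sum_(i < m) \sum_(j < n) Q i j.
Proof.
rewrite pair_big /weight -sum1dep_card big_mkcond /=.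
by apply: eq_bigr => -[i j] _; rewrite mxE /=; case: (Q i j).
Qed.

Definition border m n (Q : rel nat) : rel nat :=
  fun i j => [|| Q i j, i == m | j == n].

Lemma weight_border m n Q :
  weight (to_mx m.+1 n.+1 (border m n Q)) = weight (to_mx m n Q) + (m + n).+1.
Proof.
rewrite !weight_sum big_ord_recr /=.
have -> : \sum_(j < n.+1) border m n Q m j = n.+1.
  by rewrite (eq_bigr (fun=> 1)) ?sum1_card ?card_ord // => j _;
    rewrite /border eqxx orbT.
rewrite (eq_bigr (fun i : 'I_m => \sum_(j < n) Q i j + 1)) => [|i _].
  by rewrite big_split /= sum1_card card_ord; lia.
rewrite big_ord_recr /= /border eqxx !orbT; congr (_ + _).
by apply: eq_bigr => j _; rewrite !ltn_eqF ?ltn_ord // !orbF.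
Qed.

Definition maximal_ones m n (Q : rel nat) : {set 'I_m * 'I_n} :=
  [set p : 'I_m * 'I_n | Q p.1 p.2 && ~~ dominated m n Q p.1 p.2].

Lemma weight_nonmaximal m n Q :
  weight (to_mx m.+1 n.+1 Q) =
  weight (to_mx m n (nonmaximal m.+1 n.+1 Q)) + #|maximal_ones m.+1 n.+1 Q|.
Proof.
(* Nothing in the last row or column is dominated, so cutting them off loses no weight. *)
have -> : weight (to_mx m n (nonmaximal m.+1 n.+1 Q)) =
          weight (to_mx m.+1 n.+1 (nonmaximal m.+1 n.+1 Q)).
  have last0 i j : (m <= i) || (n <= j) -> nonmaximal m.+1 n.+1 Q i j = false.
    move=> mn; rewrite /nonmaximal; case: dominatedP; rewrite ?andbF //.
    by case=> a [b [/andP[? ?] /andP[? ?] _]]; lia.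
  rewrite !weight_sum [RHS]big_ord_recr /= [X in _ + X]big1 ?addn0.
    by apply: eq_bigr => i _; rewrite big_ord_recr /= last0 ?leqnn ?orbT ?addn0.
  by move=> j _; rewrite last0 ?leqnn.
rewrite /weight.
rewrite -(cardsID [set p : 'I_m.+1 * 'I_n.+1 | dominated m.+1 n.+1 Q p.1 p.2]).
by congr (_ + _); apply: eq_card => p; rewrite !inE !mxE // andbC.
Qed.

Lemma diagonal_subproof m n (p : 'I_m.+1 * 'I_n.+1) : p.1 + (n - p.2) < (m + n).+1.
Proof. by have := ltn_ord p.1; lia. Qed.

(** Row minus column, shifted by [n] to be nonnegative; the subtraction never truncates. *)
Definition diagonal m n (p : 'I_m.+1 * 'I_n.+1) : 'I_(m + n).+1 :=
  Ordinal (diagonal_subproof p).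

(** Of two distinct cells on one diagonal, the lower is strictly below and to the right of the
    upper, so a 1 there dominates it. *)
Lemma diagonal_inj m n Q :
  {in maximal_ones m.+1 n.+1 Q &, injective (@diagonal m n)}.
Proof.
move=> [a b] [a' b']; rewrite !inE /= => /andP[Qab nab] /andP[Qab' nab'].
move=> /(congr1 val) /= e; have [bn bn'] := (ltn_ord b, ltn_ord b').
have [] := ltngtP a a' => ha.
- case/negP: nab; apply/dominatedP; exists a', b'.
  by rewrite Qab' ha !ltn_ord; split=> //; lia.
- case/negP: nab'; apply/dominatedP; exists a, b.
  by rewrite Qab ha !ltn_ord; split=> //; lia.
- by congr (_, _); apply: val_inj => /=; lia.
Qed.

Lemma card_maximal_ones_le m n Q : #|maximal_ones m.+1 n.+1 Q| <= (m + n).+1.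
Proof.
by rewrite -(card_in_imset (@diagonal_inj m n Q)) (leq_trans (max_card _)) ?card_ord.
Qed.

Lemma card_maximal_ones k l (A : 'M[bool]_(k, l)) (Q : rel nat) m n :
    saturates (add_corner (add_corner A)) Q m.+1 n.+1 ->
  #|maximal_ones m.+1 n.+1 Q| = (m + n).+1.
Proof.
move=> sQ; rewrite -(card_in_imset (@diagonal_inj m n Q)) -[RHS]card_ord.
apply: eq_card => d; apply/imsetP.
(* [(i, j)] is the last cell of diagonal [d]: in the last column if [d <= m], in the last row if
   [d >= m]. Hence nothing dominates it. *)
pose i := minn d m; pose j := m + n - maxn d m.
have dl := ltn_ord d.
have [|||i' [j' [im jn Q' e]]] := undominated_one_on_diagonal sQ (i := i) (j := j).
- by rewrite ltnS geq_minr.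
- by rewrite /j; lia.
- apply/negP => /dominatedP[a [b [/andP[ia am] /andP[jb bn] _]]].
  by rewrite /i /j in ia jb; lia.
exists (Ordinal im, Ordinal jn); first by rewrite inE.
by apply: val_inj => /=; rewrite /i /j in e; lia.
Qed.

(** * Bordering by ones *)

Lemma border_avoids k l (B : 'M[bool]_(k, l)) (Q : rel nat) m n :
  ~ occurs B Q m n -> ~ occurs (add_corner B) (border m n Q) m.+1 n.+1.
Proof.
move=> aQ /occurs_add_corner[i [j [im jn _ oB]]]; apply: aQ.
apply: sub_occurs oB => // a b ai bj.
by rewrite /border !ltn_eqF ?orbF // ?(leq_trans ai) ?(leq_trans bj).
Qed.

(** A changed 0 lies off the border, so it creates a copy of [B] in the [m] by [n] part, and the
    border 1 at [(m, n)] supplies the corner. *)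
Lemma border_saturates k l (B : 'M[bool]_(k, l)) (Q : rel nat) m n :
  saturates B Q m n -> saturates (add_corner B) (border m n Q) m.+1 n.+1.
Proof.
move=> [aQ sQ]; split=> [|i j im jn]; first exact: border_avoids.
rewrite /border !negb_or => /and3P[nQ ni nj].
have {}im : i < m by lia.
have {}jn : j < n by lia.
apply/occurs_add_corner; exists m, n; split=> //.
  by rewrite /add_one eqxx !orbT.
apply: sub_occurs (sQ i j im jn nQ) => // a b _ _; rewrite /add_one.
by case/orP=> ->; rewrite ?orbT.
Qed.

Lemma avoids_add_corner0 k l (A : 'M[bool]_(k, l)) m n :
  avoids (add_corner A) (const_mx false : 'M[bool]_(m, n)).
Proof.
by apply: (@avoids_const0 _ _ _ _ _ (rshift k ord0) (rshift l ord0));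
  rewrite block_mxEdr mxE.
Qed.

Theorem theorem7 (k l : nat) (A : 'M[bool]_(k, l)) (m n : nat)
    (hm : 0 < m) (hn : 0 < n) :
  let P' := add_corner A in
  let P := add_corner P' in
  ex_max P m n = ex_max P' (m - 1) (n - 1) + m + n - 1 /\
  sat_min P m n = sat_min P' (m - 1) (n - 1) + m + n - 1.
Proof.
move=> P' P; case: m hm => // m _; case: n hn => // n _; rewrite !subn1 /=.
(* The zero matrix avoids both patterns, so all four extrema are attained and the default in
   [sat_min] is harmless. *)
have aP := avoids_add_corner0 P' m.+1 n.+1; have aP' := avoids_add_corner0 A m n.
have [[M avM wM] maxM] := ex_maxP aP; have [[M' avM' wM'] maxM'] := ex_maxP aP'.
have [_ /sat_minP[[S sS wS] minS]] := saturating_exists aP.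
have [_ /sat_minP[[S' sS' wS'] minS']] := saturating_exists aP'.
rewrite -/P -/P' in avM wM maxM avM' wM' maxM' sS wS minS sS' wS' minS'.
have E x : (x + m.+1 + n.+1).-1 = x + (m + n).+1 by lia.
rewrite !{}E; split; apply/eqP; rewrite eqn_leq; apply/andP; split.
- rewrite -wM -[M]entryK weight_nonmaximal leq_add ?card_maximal_ones_le //.
  by apply: maxM'; apply/avoidsP/nonmaximal_avoids/avoidsP; rewrite entryK.
- rewrite -wM' -[M']entryK -weight_border; apply: maxM.
  by apply/avoidsP/border_avoids/avoidsP; rewrite entryK.
- rewrite -wS' -[S']entryK -weight_border; apply: minS.
  by apply/saturatingP/border_saturates/saturatingP; rewrite entryK.
have /saturatingP satS : saturating P (to_mx m.+1 n.+1 (entry S)) by rewrite entryK.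
rewrite -wS -[S]entryK weight_nonmaximal (card_maximal_ones satS) leq_add2r.
exact/minS'/saturatingP/nonmaximal_saturates.
Qed.
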